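(* Let $k$ be an algebraically closed field of characteristic $0$, let $m,d$ be natural numbers (positive integers) such that $(1+m)d$ is even, and let $\xi\in k$ be a primitive $2m$-th root of $1$. Then the Hopf algebra $D=D(m,d,\xi)$ is not pointed.
   Context: A Hopf algebra is pointed if all its simple subcoalgebras are one-dimensional. Definition of $D(m,d,\xi)$. Put $\omega:=md$, $\gamma:=\xi^2$, and $\phi_i:=1-\gamma^{-i-1}x^d$ for $i\in\mathbb{Z}$. As a $k$-algebra it is generated by $x^{\pm1},g^{\pm1},y,u_0,\dots,u_{m-1}$ with relations (indices of $u$ are read modulo $m$) $$xx^{-1}=x^{-1}x=1,\quad gg^{-1}=g^{-1}g=1,\quad xg=gx,\quad xy=yx,\quad yg=\gamma gy,\quad y^m=1-x^\omega=1-g^m,$$ $$xu_i=u_ix^{-1},\quad yu_i=\phi_iu_{i+1}=\xi x^du_iy,\quad u_ig=\gamma^ix^{-2d}gu_i,$$ and, for $0\le i,j\le m-1$, $u_iu_j=(-1)^{-j}\xi^{-j}\gamma^{\frac{j(j+1)}{2}}\frac1m x^{-\frac{1+m}{2}d}\,P_{ij}\,g$, where $P_{ij}=\phi_i\phi_{i+1}\cdots\phi_{m-2-j}\,y^{i+j}$ if $i+j\le m-2$; $P_{ij}=y^{i+j}$ if $i+j=m-1$; and $P_{ij}=\phi_i\cdots\phi_{m-1}\phi_0\cdots\phi_{m-2-j}\,y^{i+j-m}$ otherwise (where $\phi_0\cdots\phi_{m-2-j}$ is the empty product $1$ if $j=m-1$). It is a Hopf algebra with $\Delta(x)=x\otimes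 x$, $\Delta(g)=g\otimes g$, $\Delta(y)=y\otimes g+1\otimes y$, $\Delta(u_i)=\sum_{j=0}^{m-1}\gamma^{j(i-j)}u_j\otimes x^{-jd}g^ju_{i-j}$; $\epsilon(x)=\epsilon(g)=\epsilon(u_0)=1$, $\epsilon(y)=\epsilon(u_s)=0$ for $1\le s\le m-1$; $S(x)=x^{-1}$, $S(g)=g^{-1}$, $S(y)=-yg^{-1}$, $S(u_i)=(-1)^i\xi^{-i}\gamma^{-\frac{i(i+1)}{2}}x^{id+\frac32(1-m)d}g^{m-i-1}u_i$ for $0\le i\le m-1$.
   Formalization: The case m = 1 is excluded (m > 1 is assumed), because D(1,d,-1) is the group algebra of the infinite dihedral group generated by x and u_0, which is pointed, so the claim fails for m = 1. *)

(* Defs.v *)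
From HB Require Import structures.
From mathcomp Require Import all_boot all_order all_algebra.
From mathcomp Require Import boolp classical_sets.

Set Implicit Arguments.
Unset Strict Implicit.
Unset Printing Implicit Defensive.

Import GRing.Theory.
Local Open Scope ring_scope.
Local Open Scope quotient_scope.

Reserved Notation "v \ox w" (at level 40, left associativity).

(* Tensor products over a field.  An element of tensor V W is a formal sum    *)
(* of pairs; two formal sums are identified when no bilinear map separates    *)
(* them.  Coefficients are absorbed in the left components.                   *)

Section Tensor.
Variables (k : fieldType) (V W : lmodType k).
Implicit Types s : seq (V * W).

Definition fsum (U : lmodType k) (b : V -> W -> U) s : U :=
  \sum_(p <- s) b p.1 p.2.

Definition teq s (t : seq (V * W)) : bool :=
  `[< forall (U : lmodType k) (b : V -> W -> U),
        bilinear_for *:%R *:%R b -> fsum b s = fsum b t >].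

Lemma teqP s (t : seq (V * W)) :
  reflect (forall (U : lmodType k) (b : V -> W -> U),
             bilinear_for *:%R *:%R b -> fsum b s = fsum b t) (teq s t).
Proof. exact: asboolP. Qed.

Lemma teq_refl : reflexive teq.
Proof. by move=> s; apply/teqP. Qed.

Lemma teq_sym : symmetric teq.
Proof.
by move=> s t; apply/teqP/teqP => h U b hb; rewrite (h U b hb).
Qed.

Lemma teq_trans : transitive teq.
Proof.
move=> t s r /teqP h1 /teqP h2; apply/teqP => U b hb.
by rewrite (h1 U b hb) (h2 U b hb).
Qed.

Definition teq_equiv := EquivRel teq teq_refl teq_sym teq_trans.

Definition tensor := {eq_quot teq_equiv}.
HB.instance Definition _ := Choice.on tensor.

Definition tclass s : tensor := \pi_({eq_quot teq_equiv}) s.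
Definition treps (t : tensor) : seq (V * W) := repr (t : {eq_quot teq_equiv}).

Definition tens (v : V) (w : W) : tensor := tclass [:: (v, w)].

(* The linear map v \ox w |-> b v w; meaningful when b is bilinear, in which  *)
(* case it does not depend on the chosen representative.                      *)
Definition tfold (U : lmodType k) (b : V -> W -> U) (t : tensor) : U :=
  fsum b (treps t).

Lemma trepsK t : tclass (treps t) = t.
Proof. exact: reprK. Qed.

Lemma tclassP s t : reflect (tclass s = tclass t) (teq s t).
Proof. exact: (@eqquotP _ teq_equiv {eq_quot teq_equiv}). Qed.

Lemma tfold_class (U : lmodType k) (b : V -> W -> U) s :
  bilinear_for *:%R *:%R b -> tfold b (tclass s) = fsum b s.
Proof.
move=> hb; have /tclassP/teqP h : tclass (treps (tclass s)) = tclass s.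
  exact: trepsK.
exact: h.
Qed.

Definition tadd (t1 t2 : tensor) := tclass (treps t1 ++ treps t2).
Definition tscale (a : k) (t : tensor) :=
  tclass [seq (a *: p.1, p.2) | p <- treps t].
Definition tzero : tensor := tclass [::].
Definition topp (t : tensor) := tscale (- 1) t.

Lemma fsum_cat (U : lmodType k) (b : V -> W -> U) s t :
  fsum b (s ++ t) = fsum b s + fsum b t.
Proof. exact: big_cat. Qed.

Lemma fsum_scale (U : lmodType k) (b : V -> W -> U) a s :
  bilinear_for *:%R *:%R b ->
  fsum b [seq (a *: p.1, p.2) | p <- s] = a *: fsum b s.
Proof.
move=> hb; rewrite /fsum big_map scaler_sumr; apply: eq_bigr => p _ /=.
exact: (scalable_linear (hb.1 p.2)).
Qed.

Lemma tensor_ext (t1 t2 : tensor) :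
  (forall (U : lmodType k) (b : V -> W -> U),
      bilinear_for *:%R *:%R b -> tfold b t1 = tfold b t2) -> t1 = t2.
Proof.
by move=> h; rewrite -(trepsK t1) -(trepsK t2); apply/tclassP/teqP.
Qed.

Lemma tfold_add (U : lmodType k) (b : V -> W -> U) t1 t2 :
  bilinear_for *:%R *:%R b -> tfold b (tadd t1 t2) = tfold b t1 + tfold b t2.
Proof. by move=> hb; rewrite tfold_class// fsum_cat. Qed.

Lemma tfold_scale (U : lmodType k) (b : V -> W -> U) a t :
  bilinear_for *:%R *:%R b -> tfold b (tscale a t) = a *: tfold b t.
Proof. by move=> hb; rewrite tfold_class// fsum_scale. Qed.

Lemma tfold_zero (U : lmodType k) (b : V -> W -> U) :
  bilinear_for *:%R *:%R b -> tfold b tzero = 0.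
Proof. by move=> hb; rewrite tfold_class// /fsum big_nil. Qed.

Let tE := (tfold_add, tfold_scale, tfold_zero).

Lemma taddA : associative tadd.
Proof. by move=> x y z; apply: tensor_ext => U b hb; rewrite !tE// addrA. Qed.

Lemma taddC : commutative tadd.
Proof. by move=> x y; apply: tensor_ext => U b hb; rewrite !tE// addrC. Qed.

Lemma tadd0 : left_id tzero tadd.
Proof. by move=> x; apply: tensor_ext => U b hb; rewrite !tE// add0r. Qed.

Lemma taddN : left_inverse tzero topp tadd.
Proof.
by move=> x; apply: tensor_ext => U b hb; rewrite !tE// scaleN1r addNr.
Qed.

HB.instance Definition _ := GRing.isZmodule.Build tensor taddA taddC tadd0 taddN.

Lemma tscaleA a b t : tscale a (tscale b t) = tscale (a * b) t.
Proof. by apply: tensor_ext => U f hf; rewrite !tE// scalerA. Qed.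

Lemma tscale1 : left_id 1 tscale.
Proof. by move=> x; apply: tensor_ext => U b hb; rewrite !tE// scale1r. Qed.

Lemma tscaleDr : right_distributive tscale +%R.
Proof.
by move=> a x y; apply: tensor_ext => U b hb; rewrite !tE// scalerDr.
Qed.

Lemma tscaleDl t : {morph tscale^~ t : a b / a + b}.
Proof.
by move=> a c; apply: tensor_ext => U b hb; rewrite !tE// scalerDl.
Qed.

HB.instance Definition _ := GRing.Zmodule_isLmodule.Build k tensor
  tscaleA tscale1 tscaleDr tscaleDl.

End Tensor.

Notation "v \ox w" := (tens v w) : ring_scope.

Section TensorTheory.
Variables (k : fieldType) (V W : lmodType k).

Lemma tfold_linear (U : lmodType k) (b : V -> W -> U) :
  bilinear_for *:%R *:%R b -> linear (tfold b).
Proof. by move=> hb a s t; rewrite tfold_add// tfold_scale. Qed.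

Lemma tfoldE (U : lmodType k) (b : V -> W -> U) v w :
  bilinear_for *:%R *:%R b -> tfold b (v \ox w) = b v w.
Proof. by move=> hb; rewrite tfold_class// /fsum big_seq1. Qed.

Lemma tens_bilinear : bilinear_for *:%R *:%R (@tens k V W).
Proof.
split=> [w a u v|v a u w]; apply: tensor_ext => U b hb;
  by rewrite (tfold_linear hb) !tfoldE// ?(hb.1 w a u v)// (hb.2 v a u w).
Qed.

Lemma linear_sumE (U U' : lmodType k) (f : U -> U') (I : Type) (r : seq I)
    (F : I -> U) :
  linear f -> f (\sum_(i <- r) F i) = \sum_(i <- r) f (F i).
Proof.
move=> hf; have fD x y : f (x + y) = f x + f y.
  by have := hf 1 x y; rewrite !scale1r.
apply: (big_morph f fD); apply: (addrI (f 0)).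
by rewrite -fD !addr0.
Qed.

Lemma tensor_sumE (t : tensor V W) :
  t = \sum_(p <- treps t) p.1 \ox p.2.
Proof.
apply: tensor_ext => U b hb; rewrite (linear_sumE _ _ (tfold_linear hb)).
by apply: eq_bigr => p _; rewrite tfoldE.
Qed.

Lemma tensor_linear_ext (U : lmodType k) (f f' : tensor V W -> U) :
  linear f -> linear f' -> (forall v w, f (v \ox w) = f' (v \ox w)) -> f =1 f'.
Proof.
move=> hf hf' E t.
rewrite (tensor_sumE t) (linear_sumE _ _ hf) (linear_sumE _ _ hf').
by apply: eq_bigr => p _; exact: E.
Qed.

End TensorTheory.

(* The algebra structure (a \ox b) * (a' \ox b') = (a * a') \ox (b * b').     *)
Section TensorAlgebra.
Variables (k : fieldType) (A B : algType k).
Implicit Types s t r : tensor A B.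

Definition tmulr (a : A) (b : B) (t : tensor A B) : tensor A B :=
  tfold (fun a' b' => (a * a') \ox (b * b')) t.

Definition tmul s t : tensor A B := tfold (fun a b => tmulr a b t) s.

Lemma tmulr_bil (a : A) (b : B) :
  bilinear_for *:%R *:%R (fun a' b' => (a * a') \ox (b * b')).
Proof.
have [hl hr] := tens_bilinear A B.
by split=> [w c u v|v c u w] /=; rewrite mulrDr -scalerAr ?hl ?hr.
Qed.

Lemma tmulrE a b a' b' : tmulr a b (a' \ox b') = (a * a') \ox (b * b').
Proof. by rewrite /tmulr tfoldE//; exact: tmulr_bil. Qed.

Lemma tmulr_linear a b : linear (tmulr a b).
Proof. exact/tfold_linear/tmulr_bil. Qed.

Lemma linear_comb (U : lmodType k) (c : k) (f g : tensor A B -> U) :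
  linear f -> linear g -> linear (fun t => c *: f t + g t).
Proof.
move=> hf hg a u v; rewrite hf hg !scalerDr !scalerA (mulrC c).
by rewrite -!addrA; congr (_ + _); rewrite addrCA.
Qed.

Lemma tmul_bil t : bilinear_for *:%R *:%R (fun a b => tmulr a b t).
Proof.
have [hl hr] := tens_bilinear A B.
split=> [b c u v|a c u v] /=.
- apply: (tensor_linear_ext (f := tmulr (c *: u + v) b)
    (f' := fun t => c *: tmulr u b t + tmulr v b t)).
  + exact: tmulr_linear.
  + by apply: linear_comb; exact: tmulr_linear.
  + by move=> a' b'; rewrite !tmulrE mulrDl -scalerAl hl.
- apply: (tensor_linear_ext (f := tmulr a (c *: u + v))
    (f' := fun t => c *: tmulr a u t + tmulr a v t)).
  + exact: tmulr_linear.
  + by apply: linear_comb; exact: tmulr_linear.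
  + by move=> a' b'; rewrite !tmulrE mulrDl -scalerAl hr.
Qed.

Lemma tmul_tens a b t : tmul (a \ox b) t = tmulr a b t.
Proof. by rewrite /tmul tfoldE//; exact: tmul_bil. Qed.

Lemma tmulE a b a' b' :
  tmul (a \ox b) (a' \ox b') = (a * a') \ox (b * b').
Proof. by rewrite tmul_tens tmulrE. Qed.

Lemma tmul_linearl t : linear (tmul^~ t).
Proof. exact/tfold_linear/tmul_bil. Qed.

Lemma tmul_linearr s : linear (tmul s).
Proof.
move=> c u v; move: s.
apply: (tensor_linear_ext (f := tmul^~ (c *: u + v))
    (f' := fun s => c *: tmul s u + tmul s v)).
- exact: tmul_linearl.
- by apply: linear_comb; exact: tmul_linearl.
- by move=> a b; rewrite !tmul_tens tmulr_linear.
Qed.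

Lemma tmulA : associative tmul.
Proof.
move=> x y z; move: x.
apply: (tensor_linear_ext (f := tmul^~ (tmul y z))
   (f' := fun x => tmul (tmul x y) z)); first exact: tmul_linearl.
  by move=> c u v; rewrite !tmul_linearl.
move=> a b; move: y.
apply: (tensor_linear_ext (f := fun y => tmul (a \ox b) (tmul y z))
   (f' := fun y => tmul (tmul (a \ox b) y) z)).
- by move=> c u v; rewrite tmul_linearl tmul_linearr.
- by move=> c u v; rewrite tmul_linearr tmul_linearl.
move=> a' b'; move: z.
apply: (tensor_linear_ext (f := fun z => tmul (a \ox b) (tmul (a' \ox b') z))
   (f' := fun z => tmul (tmul (a \ox b) (a' \ox b')) z)).
- by move=> c u v; rewrite !tmul_linearr.
- by move=> c u v; rewrite tmul_linearr.
by move=> a'' b''; rewrite !tmulE !mulrA.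
Qed.

Lemma tmul1 : left_id (1 \ox 1) tmul.
Proof.
apply: (tensor_linear_ext (f := tmul (1 \ox 1)) (f' := id)) => //.
  exact: tmul_linearr.
by move=> a b; rewrite tmulE !mul1r.
Qed.

Lemma tmulr1 : right_id (1 \ox 1) tmul.
Proof.
apply: (tensor_linear_ext (f := tmul^~ (1 \ox 1)) (f' := id)) => //.
  exact: tmul_linearl.
by move=> a b; rewrite tmulE !mulr1.
Qed.

Lemma tmulDl : left_distributive tmul +%R.
Proof. by move=> x y z; have := tmul_linearl z 1 x y; rewrite !scale1r. Qed.

Lemma tmulDr : right_distributive tmul +%R.
Proof. by move=> x y z; have := tmul_linearr x 1 y z; rewrite !scale1r. Qed.

HB.instance Definition _ := GRing.Zmodule_isPzRing.Build (tensor A B)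
  tmulA tmul1 tmulr1 tmulDl tmulDr.

Lemma tensM a b a' b' :
  (a \ox b) * (a' \ox b') = (a * a') \ox (b * b') :> tensor A B.
Proof. exact: tmulE. Qed.

End TensorAlgebra.

Definition tmap (k : fieldType) (V W V' W' : lmodType k)
    (f : V -> V') (g : W -> W') : tensor V W -> tensor V' W' :=
  tfold (fun v w => f v \ox g w).

Definition tassoc (k : fieldType) (U V W : lmodType k) :
    tensor (tensor U V) W -> tensor U (tensor V W) :=
  tfold (fun t w => tfold (fun u v => u \ox (v \ox w)) t).

HB.mixin Record Lmodule_isCoalgebra (k : fieldType) C of GRing.Lmodule k C := {
  comul : C -> tensor C C;
  counit : C -> k;
  comul_linear : linear comul;
  counit_linear : scalar counit;
  comulA : forall c,
    tassoc (tmap comul id (comul c)) = tmap id comul (comul c);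
  counitl : forall c, tfold (fun a b => counit a *: b) (comul c) = c;
  counitr : forall c, tfold (fun a b => counit b *: a) (comul c) = c
}.

#[short(type="coalgType")]
HB.structure Definition Coalgebra (k : fieldType) :=
  {C of GRing.Lmodule k C & Lmodule_isCoalgebra k C}.

HB.mixin Record Algebra_isHopfAlgebra (k : fieldType) H
    of GRing.Algebra k H & Coalgebra k H := {
  antipode : H -> H;
  comul_monoid_morphism : monoid_morphism (comul : H -> tensor H H);
  counit_monoid_morphism : monoid_morphism (counit : H -> k);
  antipode_linear : linear antipode;
  antipodel : forall h,
    tfold (fun a b => antipode a * b) (comul h) = (counit h)%:A;
  antipoder : forall h,
    tfold (fun a b => a * antipode b) (comul h) = (counit h)%:A
}.

#[short(type="hopfAlgType")]
HB.structure Definition HopfAlgebra (k : fieldType) :=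
  {H of GRing.Algebra k H & Coalgebra k H & Algebra_isHopfAlgebra k H}.

Section Pointed.
Local Open Scope classical_set_scope.

Definition subspace (k : fieldType) (V : lmodType k) (E : set V) :=
  E 0 /\ forall (a : k) u v, E u -> E v -> E (a *: u + v).

(* The image of E \ox F in V \ox W. *)
Definition tensor_sub (k : fieldType) (V W : lmodType k)
    (E : set V) (F : set W) : set (tensor V W) :=
  [set t | exists2 s : seq (V * W),
     (forall p, p \in s -> E p.1 /\ F p.2) & t = \sum_(p <- s) p.1 \ox p.2].

Definition one_dimensional (k : fieldType) (V : lmodType k) (E : set V) :=
  exists2 v : V, v != 0 & E = [set a *: v | a in [set: k]].

Variables (k : fieldType) (C : coalgType k).

Definition subcoalgebra (E : set C) :=
  subspace E /\ forall c, E c -> tensor_sub E E (comul c).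

Definition simple_subcoalgebra (E : set C) :=
  [/\ subcoalgebra E, E <> [set 0]
    & forall F, subcoalgebra F -> F `<=` E -> F = [set 0] \/ F = E].

Definition pointed := forall E, simple_subcoalgebra E -> one_dimensional E.

End Pointed.

(* The generators x, x^-1, g, g^-1, y, u_i.  The family u is indexed by all   *)
(* integers; D_relations imposes u_(i + m) = u_i.                             *)
Record D_generators (A : Type) := DGenerators {
  genX : A;
  genXV : A;
  genG : A;
  genGV : A;
  genY : A;
  genU : int -> A
}.

Definition D_gen_map (A B : Type) (f : A -> B) (a : D_generators A) :
    D_generators B :=
  DGenerators (f (genX a)) (f (genXV a)) (f (genG a)) (f (genGV a))
    (f (genY a)) (fun i => f (genU a i)).

Section DRelations.
Variables (k : fieldType) (m d : nat) (xi : k).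

Let gamma := xi ^+ 2.

Section InAlgebra.
Variables (A : algType k) (a : D_generators A).

Let x := genX a.
Let g := genG a.
Let gV := genGV a.
Let y := genY a.
Let u := genU a.

Definition powX (n : int) : A :=
  match n with Posz p => genX a ^+ p | Negz p => genXV a ^+ p.+1 end.

Definition D_phi (i : int) : A := 1 - gamma ^ (- i - 1) *: x ^+ d.

(* Defined for i, j < m. *)
Definition D_P (i j : nat) : A :=
  if (i + j + 2 <= m)%N then
    (\prod_(i <= l < m - 1 - j) D_phi l%:Z) * y ^+ (i + j)
  else if (i + j + 1 == m)%N then y ^+ (i + j)
  else (\prod_(i <= l < m) D_phi l%:Z)
       * (\prod_(0 <= l < m - 1 - j) D_phi l%:Z) * y ^+ (i + j - m).

Definition D_relations_xgy : Prop :=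
  [/\ x * genXV a = 1 /\ genXV a * x = 1,
      g * gV = 1 /\ gV * g = 1,
      [/\ x * g = g * x, x * y = y * x & y * g = gamma *: (g * y)],
      y ^+ m = 1 - x ^+ (m * d)
    & 1 - x ^+ (m * d) = 1 - g ^+ m].

Definition D_relations_u : Prop :=
  [/\ forall i, u (i + m%:Z) = u i,
      forall i, x * u i = u i * genXV a,
      forall i, y * u i = D_phi i * u (i + 1),
      forall i, D_phi i * u (i + 1) = xi *: (x ^+ d * u i * y)
    & forall i, u i * g = gamma ^ i *: (powX (- (2 * d)%:Z) * g * u i)].

(* (1 + m) * d is even, so the exponent of x is - ((1 + m) / 2) d. *)
Definition D_relations_uu : Prop :=
  forall i j : nat, (i < m)%N -> (j < m)%N ->
    u i%:Z * u j%:Z =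
      ((- 1) ^ (- j%:Z) * xi ^ (- j%:Z) * gamma ^+ ((j * (j + 1))./2)
         * m%:R^-1)
      *: (powX (- (((1 + m) * d)./2)%:Z) * D_P i j * g).

Definition D_relations : Prop :=
  [/\ D_relations_xgy, D_relations_u & D_relations_uu].

End InAlgebra.

(* A is the k-algebra presented by the generators a and the relations. *)
Definition D_presentation (A : algType k) (a : D_generators A) : Prop :=
  D_relations a /\
  forall (B : algType k) (b : D_generators B), D_relations b ->
    exists f : {lrmorphism A -> B}, D_gen_map f a = b /\
      forall f' : {lrmorphism A -> B}, D_gen_map f' a = b -> f' =1 f.

Section InHopfAlgebra.
Variables (H : hopfAlgType k) (a : D_generators H).

Let x := genX a.
Let g := genG a.
Let gV := genGV a.
Let y := genY a.
Let u := genU a.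

Definition D_comul : Prop :=
  [/\ comul x = x \ox x, comul g = g \ox g, comul y = y \ox g + 1 \ox y
    & forall i : nat, (i < m)%N ->
      comul (u i%:Z) = \sum_(0 <= j < m)
        gamma ^ (j%:Z * (i%:Z - j%:Z))
        *: (u j%:Z \ox (powX a (- (j * d)%:Z) * g ^+ j * u (i%:Z - j%:Z)))].

Definition D_counit : Prop :=
  [/\ counit x = 1, counit g = 1, counit (u 0) = 1, counit y = 0
    & forall s : nat, (1 <= s < m)%N -> counit (u s%:Z) = 0].

(* (m - 1) * d has the parity of (1 + m) * d, so the second summand of the    *)
(* exponent of x is (3 / 2) (1 - m) d.                                        *)
Definition D_antipode : Prop :=
  [/\ antipode x = genXV a, antipode g = gV, antipode y = - (y * gV)
    & forall i : nat, (i < m)%N ->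
      antipode (u i%:Z) =
        ((- 1) ^+ i * xi ^ (- i%:Z) * gamma ^ (- ((i * (i + 1))./2)%:Z))
        *: (powX a ((i * d)%:Z - (3 * ((m - 1) * d)./2)%:Z)
            * g ^+ (m - i - 1) * u i%:Z)].

End InHopfAlgebra.

(* The presentation, together with comul, counit and antipode on generators,  *)
(* determines D(m, d, xi) up to a unique isomorphism matching the generators. *)
(* D(1, d, -1) is the group algebra of the infinite dihedral group <x, u_0>,  *)
(* which is pointed, so results on non-pointedness require 1 < m.             *)
Definition is_D (H : hopfAlgType k) : Prop :=
  exists a : D_generators H,
    [/\ D_presentation a, D_comul a, D_counit a & D_antipode a].

End DRelations.

(* Main.v *)
Require Import Defs.
From mathcomp Require Import all_boot all_order all_algebra.
From mathcomp Require Import boolp classical_sets.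
From mathcomp Require Import ring zify.

(** Write gamma = xi^2, a primitive m-th root of 1, and let z = x^(-d) g, a
    group-like element with z^m = 1.  Rescaling the elements z^b u_j by powers
    of gamma, the m^2 elements
      e_(b,c) = gamma^(b (c - b)) z^b u_(c - b)        (b, c modulo m)
    satisfy Delta(e_(b,c)) = sum_i e_(b,i) (x) e_(i,c), so they span the image
    of the m x m matrix coalgebra, the dual of the matrix algebra M_m.  The
    idea is that this image is all of it: a simple subcoalgebra of dimension
    m^2 > 1, which is incompatible with D being pointed.

    A linear form phi on D induces a matrix (phi(e_(b,c)))_(b,c), and the
    convolution of forms induces the product of matrices
    (functional_matrixM).  If all matrices arise in this way, then every
    nonzero element of the span generates the whole span, by letting forms act
    on both sides as matrix units (simple_comatrix_span), and the span is not
    a line (comatrix_span_not_one_dimensional).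

    It remains to find enough linear forms.  Since D is given by a
    presentation, it could a priori be too small; but it has a representation
    by upper triangular 2 x 2 matrices (rep_D_relations)
      x = 1,  g = diag(1, gamma),  y = E_01,  u_0 = diag(1, xi),
      u_1 = kappa E_01 with kappa = xi / (1 - gamma^-1),  u_2 = ... = 0.
    Its three nonzero matrix entries are linear forms on D, and the
    matrices that they induce are the identity, xi diag(gamma^b)_b and a
    weighted cyclic shift (rep_entry).  A diagonal matrix with distinct
    entries together with a cyclic shift generates M_m
    (generated_delta_mx). *)

Set Implicit Arguments.
Unset Strict Implicit.
Unset Printing Implicit Defensive.

Import GRing.Theory.
Local Open Scope ring_scope.

(** * Linear forms acting on subcoalgebras *)

Section Convolution.
Variables (k : fieldType) (C : coalgType k).

Lemma convolution_bilinear (phi psi : C -> k) :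
  scalar phi -> scalar psi ->
  bilinear_for *:%R *:%R (fun a b => phi a * psi b : k^o).
Proof.
move=> hphi hpsi; split=> [b c u v|a c u v] /=.
- by rewrite hphi mulrDl -mulrA.
- by rewrite hpsi mulrDr mulrCA.
Qed.

Lemma actl_bilinear (phi : C -> k) :
  scalar phi -> bilinear_for *:%R *:%R (fun a b : C => phi a *: b).
Proof.
move=> hphi; split=> [b c u v|a c u v] /=.
- by rewrite hphi scalerDl scalerA.
- by rewrite scalerDr !scalerA mulrC.
Qed.

Lemma actr_bilinear (phi : C -> k) :
  scalar phi -> bilinear_for *:%R *:%R (fun a b : C => phi b *: a).
Proof.
move=> hphi; split=> [b c u v|a c u v] /=.
- by rewrite scalerDr !scalerA mulrC.
- by rewrite hphi scalerDl scalerA.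
Qed.

Lemma subspaceZ (V : lmodType k) (E : set V) (c : k) u :
  subspace E -> E u -> E (c *: u).
Proof. by move=> [E0 El] Eu; rewrite -[_ *: _]addr0; exact: El. Qed.

Lemma subspace_sum (V : lmodType k) (E : set V) (I : eqType) (r : seq I)
    (F : I -> V) :
  subspace E -> (forall i, i \in r -> E (F i)) -> E (\sum_(i <- r) F i).
Proof.
move=> [E0 El] hF; rewrite big_seq; apply: big_ind => // u v Eu Ev.
by rewrite -[u]scale1r; exact: El.
Qed.

Lemma subspace_tensor_sub (V W : lmodType k) (E : set V) (F : set W) :
  subspace E -> subspace (tensor_sub E F).
Proof.
move=> sE; split=> [|e _ _ [s hs ->] [t ht ->]].
  by exists [::]; rewrite ?big_nil.
exists ([seq (e *: q.1, q.2) | q <- s] ++ t) => [q|].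
  rewrite mem_cat => /orP[/mapP[r /hs[Er Fr] ->]|/ht//]; split=> //=.
  exact: subspaceZ.
rewrite big_cat big_map scaler_sumr; congr (_ + _); apply: eq_bigr => q _ /=.
by rewrite -(scalable_linear ((tens_bilinear V W).1 q.2)).
Qed.

Lemma subcoalgebra_actl (E : set C) (phi : C -> k) c :
  subcoalgebra E -> scalar phi -> E c ->
  E (tfold (fun a b : C => phi a *: b) (comul c)).
Proof.
move=> [sE hE] hphi /hE[s hs ->].
have hb := actl_bilinear hphi; rewrite (linear_sumE _ _ (tfold_linear hb)).
under eq_bigr do rewrite tfoldE//.
by apply: subspace_sum => // p /hs[? ?]; exact: subspaceZ.
Qed.

Lemma subcoalgebra_actr (E : set C) (phi : C -> k) c :
  subcoalgebra E -> scalar phi -> E c ->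
  E (tfold (fun a b : C => phi b *: a) (comul c)).
Proof.
move=> [sE hE] hphi /hE[s hs ->].
have hb := actr_bilinear hphi; rewrite (linear_sumE _ _ (tfold_linear hb)).
under eq_bigr do rewrite tfoldE//.
by apply: subspace_sum => // p /hs[? ?]; exact: subspaceZ.
Qed.

End Convolution.

(** * Comatrix coalgebras *)

Lemma delta_mx_mulmx_delta (R : comNzRingType) (n : nat) (p : 'M[R]_n)
    (a b c d : 'I_n) :
  delta_mx b a *m p *m delta_mx d c = p a d *: delta_mx b c.
Proof.
rewrite -(mul_delta_mx (ord0 : 'I_1) b a) -(mul_delta_mx (ord0 : 'I_1) d c).
rewrite -[_ *m p]mulmxA -rowE -mulmxA [row a p *m _]mulmxA -colE.
rewrite [col d _]mx11_scalar !mxE mul_scalar_mx -scalemxAr.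
by rewrite mul_delta_mx.
Qed.

Section Comatrix.
Variables (k : fieldType) (C : coalgType k) (n : nat).
Variable f : 'I_n -> 'I_n -> C.
Hypothesis comul_f : forall a b, comul (f a b) = \sum_c f a c \ox f c b.

Definition comatrix_comb (p : 'M[k]_n) : C := \sum_a \sum_b p a b *: f a b.

Definition comatrix_span : set C :=
  [set c | exists p, c = comatrix_comb p]%classic.

(** The image of the algebra map from the dual of C to matrices defined by f. *)
Definition functional_matrix (M : 'M[k]_n) : Prop :=
  exists2 phi : C -> k, scalar phi & forall a b, phi (f a b) = M a b.

Lemma functional_matrix_lin (c : k) M N :
  functional_matrix M -> functional_matrix N ->
  functional_matrix (c *: M + N).
Proof.
move=> [phi hphi phiE] [psi hpsi psiE].
exists (fun v => c * phi v + psi v); last first.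
  by move=> a b; rewrite phiE psiE !mxE.
by move=> e u v; rewrite hphi hpsi; ring.
Qed.

(** The product comes from the convolution of linear forms. *)
Lemma functional_matrixM M N :
  functional_matrix M -> functional_matrix N -> functional_matrix (M *m N).
Proof.
move=> [phi hphi phiE] [psi hpsi psiE].
have hb := convolution_bilinear hphi hpsi.
exists (fun v => tfold (fun a b => phi a * psi b : k^o) (comul v)).
  by move=> e u v; rewrite comul_linear (tfold_linear hb).
move=> a b; rewrite comul_f (linear_sumE _ _ (tfold_linear hb)) mxE.
by apply: eq_bigr => c _; rewrite tfoldE// phiE psiE.
Qed.

Lemma comatrix_comb_lin e p q :
  comatrix_comb (e *: p + q) = e *: comatrix_comb p + comatrix_comb q.
Proof.
rewrite scaler_sumr -big_split; apply: eq_bigr => a _.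
rewrite scaler_sumr -big_split; apply: eq_bigr => b _ /=.
by rewrite !mxE scalerDl scalerA.
Qed.

Lemma comatrix_comb0 : comatrix_comb 0 = 0.
Proof. by apply: big1 => a _; apply: big1 => b _; rewrite mxE scale0r. Qed.

Lemma comatrix_comb_delta a b : comatrix_comb (delta_mx a b) = f a b.
Proof.
rewrite /comatrix_comb (bigD1 a)//= [X in _ + X]big1 => [|c ca].
  rewrite addr0 (bigD1 b)//= big1 ?addr0 => [|c cb].
    by rewrite mxE !eqxx scale1r.
  by rewrite mxE (negbTE cb) andbF scale0r.
by rewrite big1// => e _; rewrite mxE (negbTE ca) scale0r.
Qed.

Lemma subspace_comatrix_span : subspace comatrix_span.
Proof.
split=> [|e _ _ [p ->] [q ->]]; first by exists 0; rewrite comatrix_comb0.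
by exists (e *: p + q); rewrite comatrix_comb_lin.
Qed.

Lemma mem_comatrix_span a b : comatrix_span (f a b).
Proof. by exists (delta_mx a b); rewrite comatrix_comb_delta. Qed.

Lemma tensor_sub_comatrix_span (p : 'M[k]_n) :
  tensor_sub comatrix_span comatrix_span (comul (comatrix_comb p)).
Proof.
have sC := subspace_comatrix_span.
have sT := subspace_tensor_sub comatrix_span sC.
rewrite (linear_sumE _ _ comul_linear).
apply: subspace_sum => // a _; rewrite (linear_sumE _ _ comul_linear).
apply: subspace_sum => // b _.
rewrite (scalable_linear comul_linear); apply: subspaceZ => //; rewrite comul_f.
apply: subspace_sum => // c _; exists [:: (f a c, f c b)].
  by move=> q; rewrite inE => /eqP->; split; exact: mem_comatrix_span.
by rewrite big_seq1.
Qed.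

Lemma subcoalgebra_comatrix_span : subcoalgebra comatrix_span.
Proof.
split=> [|_ [p ->]]; first exact: subspace_comatrix_span.
exact: tensor_sub_comatrix_span.
Qed.

(** The two actions of linear forms on the span become matrix
    multiplications, so that forms inducing matrix units can isolate single
    coefficients. *)
Lemma comatrix_actl (phi : C -> k) (M p : 'M[k]_n) :
  scalar phi -> (forall a b, phi (f a b) = M a b) ->
  tfold (fun u v : C => phi u *: v) (comul (comatrix_comb p))
  = comatrix_comb (M^T *m p).
Proof.
move=> hphi phiM; have hb := actl_bilinear hphi.
pose L v := tfold (fun u v : C => phi u *: v) (comul v).
have hL : linear L by move=> e u v; rewrite /L comul_linear (tfold_linear hb).
have Lf a b : L (f a b) = \sum_c M a c *: f c b.
  rewrite /L comul_f (linear_sumE _ _ (tfold_linear hb)).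
  by apply: eq_bigr => c _; rewrite tfoldE// phiM.
rewrite -/(L _) (linear_sumE _ _ hL).
under eq_bigr do rewrite (linear_sumE _ _ hL).
rewrite exchange_big [RHS]exchange_big; apply: eq_bigr => b _ /=.
under eq_bigr => a _.
  rewrite (scalable_linear hL) Lf/= scaler_sumr; over.
rewrite exchange_big; apply: eq_bigr => c _ /=.
by rewrite !mxE scaler_suml; apply: eq_bigr => a _; rewrite mxE scalerA mulrC.
Qed.

Lemma comatrix_actr (phi : C -> k) (M p : 'M[k]_n) :
  scalar phi -> (forall a b, phi (f a b) = M a b) ->
  tfold (fun u v : C => phi v *: u) (comul (comatrix_comb p))
  = comatrix_comb (p *m M^T).
Proof.
move=> hphi phiM; have hb := actr_bilinear hphi.
pose L v := tfold (fun u v : C => phi v *: u) (comul v).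
have hL : linear L by move=> e u v; rewrite /L comul_linear (tfold_linear hb).
have Lf a b : L (f a b) = \sum_c M c b *: f a c.
  rewrite /L comul_f (linear_sumE _ _ (tfold_linear hb)).
  by apply: eq_bigr => c _; rewrite tfoldE// phiM.
rewrite -/(L _) (linear_sumE _ _ hL); apply: eq_bigr => a _.
rewrite (linear_sumE _ _ hL).
under eq_bigr => b _.
  rewrite (scalable_linear hL) Lf/= scaler_sumr; over.
rewrite exchange_big; apply: eq_bigr => c _ /=.
by rewrite !mxE scaler_suml; apply: eq_bigr => b _; rewrite mxE scalerA.
Qed.

Hypothesis full : forall a b, functional_matrix (delta_mx a b).

(** If p a d is nonzero, acting with matrix units on both sides sends the
    combination with coefficients p to p a d times any chosen entry f b c.
    Hence a nonzero subcoalgebra contains every entry. *)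
Lemma simple_comatrix_span : (0 < n)%N -> simple_subcoalgebra comatrix_span.
Proof.
move=> n_gt0; split; first exact: subcoalgebra_comatrix_span.
  pose a := Ordinal n_gt0; have [phi hphi phiE] := full a a.
  have := mem_comatrix_span a a; move=> + C0; rewrite C0 => f0.
  have := scalable_linear hphi 0 (f a a).
  rewrite [f a a]f0 /= scaler0 mul0r -[in LHS]f0 phiE mxE !eqxx.
  by move/eqP; rewrite oner_eq0.
move=> F sF FC.
have [F0|nz] := pselect (F = [set 0]%classic); [by left|right].
have [p [Fp p_neq0]] : exists p, F (comatrix_comb p) /\ p != 0.
  apply: contra_notP nz => nz; apply/seteqP; split=> [c Fc|_ ->]; last first.
    exact: sF.1.1.
  have [p cE] := FC _ Fc; rewrite cE in Fc *.
  have [->|p0] := eqVneq p 0; last by case: nz; exists p.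
  exact: comatrix_comb0.
have [a [d pad]] : exists a d, p a d != 0.
  apply: contra_neqP p_neq0 => h; apply/matrixP => a d; rewrite mxE.
  by apply: contra_notP h => /eqP; exists a, d.
have Ff b c : F (f b c).
  have [phi hphi phiE] := full a b; have [psi hpsi psiE] := full c d.
  have := subcoalgebra_actr sF hpsi (subcoalgebra_actl sF hphi Fp).
  rewrite (comatrix_actl _ hphi phiE) (comatrix_actr _ hpsi psiE).
  rewrite !trmx_delta delta_mx_mulmx_delta.
  rewrite (scalable_linear comatrix_comb_lin) comatrix_comb_delta => Fpf.
  by have := subspaceZ (p a d)^-1 sF.1 Fpf; rewrite scalerA mulVf// scale1r.
apply/seteqP; split=> // _ [q ->].
do 2![apply: subspace_sum => [|? _]; first exact: sF.1].
by apply: subspaceZ => //; exact: sF.1.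
Qed.

(** Linear forms separate the entry (0, 0) from the entry (0, 1). *)
Lemma comatrix_span_not_one_dimensional :
  (1 < n)%N -> ~ one_dimensional comatrix_span.
Proof.
move=> n_gt1 [v _ Cv]; pose a := Ordinal (ltnW n_gt1); pose b := Ordinal n_gt1.
have [al _ fa] : [set al *: v | al in [set: k]]%classic (f a a).
  by rewrite -Cv; exact: mem_comatrix_span.
have [be _ fb] : [set be *: v | be in [set: k]]%classic (f a b).
  by rewrite -Cv; exact: mem_comatrix_span.
have [phi hphi phiE] := full a a; have [psi hpsi psiE] := full a b.
have /eqP := phiE a a; have /eqP := phiE a b; have /eqP := psiE a b.
rewrite -fa -fb !(scalable_linear hphi) !(scalable_linear hpsi) /= !mxE /=.
case: (eqVneq be 0) => [->|be0]; first by rewrite mul0r eq_sym oner_eq0.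
rewrite mulf_eq0 (negbTE be0) /= => _ /eqP->.
by rewrite mulr0 eq_sym oner_eq0.
Qed.

End Comatrix.

(** * Matrix algebras containing a separating diagonal and a cyclic shift *)

Section MatrixUnits.
Variables (k : fieldType) (n : nat) (P : 'M[k]_n -> Prop).
Hypothesis P1 : P 1%:M.
Hypothesis P_lin : forall c M N, P M -> P N -> P (c *: M + N).
Hypothesis PM : forall M N, P M -> P N -> P (M *m N).
Variables (d : 'rV[k]_n) (sigma : 'I_n -> 'I_n) (w : 'I_n -> k).
Hypothesis d_inj : injective (d 0).
Hypothesis w_neq0 : forall a, w a != 0.
Hypothesis sigma_trans : forall a b, exists i, iter i sigma a = b.
Hypothesis Pd : P (diag_mx d).
Hypothesis PN : P (\matrix_(a, b) (w a *+ (b == sigma a))).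

Lemma closedZ c M : P M -> P (c *: M).
Proof.
by rewrite -[c](subrK 1) scalerDl scale1r => PM'; exact: P_lin.
Qed.

(** These are polynomials in diag d, with prescribed roots. *)
Lemma closed_diag_prod (r : seq k) :
  P (diag_mx (\row_a \prod_(z <- r) (d 0 a - z))).
Proof.
elim: r => [|z r IH].
  suff -> : diag_mx (\row_a \prod_(z <- [::]) (d 0 a - z)) = 1%:M by [].
  by apply/matrixP => a b; rewrite !mxE big_nil.
suff -> : diag_mx (\row_a \prod_(z <- z :: r) (d 0 a - z))
    = (- z *: 1%:M + diag_mx d) *m diag_mx (\row_a \prod_(z <- r) (d 0 a - z)).
  by apply: PM => //; exact: P_lin.
rewrite mulmxDl -scalemxAl mul1mx mulmx_diag; apply/matrixP => a b.
by rewrite !mxE big_cons mulrnAr -mulrnDl; congr (_ *+ _); ring.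
Qed.

(** Lagrange interpolation at the distinct values of d gives the diagonal
    matrix units; multiplying on the right by the shift moves the column along
    the orbit of sigma. *)
Lemma generated_delta_mx a b : P (delta_mx a b).
Proof.
have Paa : P (delta_mx a a).
  pose r := [seq d 0 c | c <- enum 'I_n & c != a].
  pose e := \prod_(z <- r) (d 0 a - z).
  have e0 : e != 0.
    rewrite prodf_seq_neq0; apply/allP => _ /mapP[c + ->] /=.
    rewrite mem_filter subr_eq0 => /andP[ca _].
    by apply: contra_neq ca => /d_inj.
  suff -> : delta_mx a a
      = e^-1 *: diag_mx (\row_c \prod_(z <- r) (d 0 c - z)).
    exact/closedZ/closed_diag_prod.
  apply/matrixP => i j; rewrite !mxE.
  have [->|ia] := eqVneq i a.
    by rewrite -/e mulrnAr mulVf// eq_sym.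
  suff -> : \prod_(z <- r) (d 0 i - z) = 0 by rewrite mul0rn mulr0.
  apply/eqP; rewrite prodf_seq_eq0; apply/hasP; exists (d 0 i).
    by apply: map_f; rewrite mem_filter ia mem_enum.
  by rewrite /= subrr.
have [i <-] := sigma_trans a b; elim: i => //= i; set c := iter i sigma a => IH.
suff -> : delta_mx a (sigma c)
    = (w c)^-1 *: (delta_mx a c *m \matrix_(a, b) (w a *+ (b == sigma a))).
  exact/closedZ/PM.
apply/matrixP => p q; rewrite !mxE (bigD1 c)//= big1 => [|e ec].
  rewrite !mxE eqxx andbT addr0.
  by case: (p == a); case: (q == _); rewrite ?mul0r ?mulr0 ?mul1r ?mulVf.
by rewrite !mxE (negbTE ec) andbF mul0r.
Qed.

End MatrixUnits.

(** * Powers and products of roots of unity *)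

Lemma expfz_dvd (R : unitRingType) (z : R) (m : nat) (i : int) :
  z ^+ m = 1 -> (m%:Z %| i)%Z -> z ^ i = 1.
Proof.
by move=> zm /dvdzP[q ->]; rewrite mulrC -exprz_exp -exprnP zm exp1rz.
Qed.

(** The product is the value at 1 of (X^(n+1) - 1) / (X - 1), that is, the
    derivative of X^(n+1) at 1. *)
Lemma prod_1_sub_primitive_root (F : fieldType) (n : nat) (z : F) :
  n.+1.-primitive_root z -> \prod_(0 <= l < n) (1 - z ^+ l.+1) = n.+1%:R.
Proof.
move=> z_prim; have := factor_Xn_sub_1 z_prim.
rewrite big_nat_recl// expr0 => /(congr1 (fun p => p^`().[1])).
rewrite !derivE !hornerE subrr mul0r subr0 mul1r addr0.
rewrite hornerMn hornerXn expr1n subr0.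
rewrite horner_prod => <-; apply: eq_bigr => i _.
by rewrite !hornerE.
Qed.

(** * A representation by upper triangular matrices of size 2 *)

Section UpperTriangular.
Variable k : fieldType.

Definition upper (a b c : k) : 'M[k]_2 :=
  \matrix_(i, j) if i == 0 then if j == 0 then a else b
                 else if j == 0 then 0 else c.

Lemma upperZ e a b c : e *: upper a b c = upper (e * a) (e * b) (e * c).
Proof.
by apply/matrixP => i j; rewrite !mxE; case: (i == 0); case: (j == 0);
  rewrite ?mulr0.
Qed.

Lemma upper1 : 1 = upper 1 0 1.
Proof.
apply/matrixP => i j; rewrite !mxE.
by case: i j => [[|[|//]] ?] [[|[|//]] ?].
Qed.

Lemma upper0 : 0 = upper 0 0 0.
Proof.
by apply/matrixP => i j; rewrite !mxE; case: (i == 0); case: (j == 0).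
Qed.

Lemma upperM a b c a' b' c' :
  upper a b c * upper a' b' c' = upper (a * a') (a * b' + b * c') (c * c').
Proof.
apply/matrixP => i j; rewrite !mxE !big_ord_recl big_ord0 !mxE /=.
by case: (i == 0); case: (j == 0);
  rewrite /= ?addr0 ?mulr0 ?mul0r ?add0r ?addr0.
Qed.

Lemma upperX a c n : upper a 0 c ^+ n = upper (a ^+ n) 0 (c ^+ n).
Proof.
elim: n => [|n IH]; first by rewrite !expr0 upper1.
by rewrite !exprS IH upperM mulr0 mul0r addr0.
Qed.

End UpperTriangular.

Section Representation.
Variables (k : fieldType) (m d : nat) (xi : k).
Hypotheses (m_gt1 : (1 < m)%N) (xi_prim : (2 * m).-primitive_root xi).

Let gamma := xi ^+ 2.

Lemma gamma_prim : m.-primitive_root gamma.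
Proof.
have := exp_prim_root xi_prim 2.
by rewrite gcdnMr mulKn.
Qed.

Let gamma_m : gamma ^+ m = 1. Proof. exact: prim_expr_order gamma_prim. Qed.

Lemma xi_neq0 : xi != 0.
Proof. by rewrite (prim_root_eq0 xi_prim) muln_eq0 /= -lt0n ltnW. Qed.

Let gamma_neq0 : gamma != 0. Proof. by rewrite expf_neq0// xi_neq0. Qed.

Lemma gamma_neq1 : gamma != 1.
Proof. by rewrite -[gamma]expr1 -(prim_order_dvd gamma_prim) gtnNdvd. Qed.

Lemma prod_phi : \prod_(0 <= l < m - 1) (1 - gamma ^ (- l%:Z - 1)) = m%:R.
Proof.
have [n mE] : exists n, m = n.+1 by exists m.-1; lia.
have g_prim : n.+1.-primitive_root gamma by rewrite -mE gamma_prim.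
(* Reversing the order turns gamma^(-l-1) into gamma^(l+1-m) = gamma^(l+1). *)
rewrite mE subn1 /= -(prod_1_sub_primitive_root g_prim) big_nat_rev /=.
apply: eq_big_nat => l /andP[_ ln]; congr (1 - _).
rewrite -[gamma ^ _]mulr1 -[X in _ * X]gamma_m exprnP -expfzDr// mE exprnP.
by congr (_ ^ _); lia.
Qed.

Let kappa := xi / (1 - gamma^-1).

Let kappa_den : 1 - gamma^-1 != 0.
Proof. by rewrite subr_eq0 eq_sym invr_eq1 gamma_neq1. Qed.

Let gamma_den : 1 - gamma != 0.
Proof. by rewrite subr_eq0 eq_sym gamma_neq1. Qed.

(** The relation y u_0 = phi_0 u_1 determines kappa. *)
Definition rep_u (i : int) : 'M[k]_2 :=
  if (m %| i)%Z then upper 1 0 xi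
  else if (m %| i - 1)%Z then upper 0 kappa 0 else 0.

Definition rep_gens : D_generators 'M[k]_2 :=
  DGenerators 1 1 (upper 1 0 gamma) (upper 1 0 gamma^-1) (upper 0 1 0) rep_u.

Let ndvd1 i : (m %| i)%Z -> (m %| i - 1)%Z = false.
Proof.
by move=> mi; rewrite rpredBl// dvdz1; apply/negbTE; rewrite neq_ltn m_gt1 orbT.
Qed.

Lemma rep_u0 : rep_u 0 = upper 1 0 xi.
Proof. by rewrite /rep_u dvdz0. Qed.

Lemma rep_u1 : rep_u 1 = upper 0 kappa 0.
Proof. by rewrite /rep_u subrr dvdz0 ifN// dvdz1 neq_ltn m_gt1 orbT. Qed.

Lemma rep_u_ge2 (i : nat) : (1 < i < m)%N -> rep_u i%:Z = 0.
Proof.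
move=> /andP[i1 im]; rewrite /rep_u !ifN// ?subzn ?(ltnW i1)// dvdzE !absz_nat.
  by rewrite gtnNdvd ?subn_gt0// (leq_ltn_trans (leq_subr _ _)).
by rewrite gtnNdvd// ltnW.
Qed.

Lemma rep_phi (i : int) :
  D_phi d xi rep_gens i = (1 - gamma ^ (- i - 1))%:A.
Proof. by rewrite /D_phi /= expr1n scalerBl scale1r. Qed.

Lemma rep_prod_phi (a b : nat) :
  \prod_(a <= l < b) D_phi d xi rep_gens l%:Z
  = (\prod_(a <= l < b) (1 - gamma ^ (- l%:Z - 1)))%:A.
Proof.
rewrite -in_algE rmorph_prod; apply: eq_bigr => l _.
by rewrite rep_phi.
Qed.

Lemma rep_yu i : upper 0 1 0 * rep_u i = if (m %| i)%Z then upper 0 xi 0 else 0.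
Proof.
rewrite /rep_u; case: ifP => _; first by rewrite upperM; congr upper; ring.
case: ifP => _; last by rewrite mulr0.
by rewrite upperM [RHS]upper0; congr upper; ring.
Qed.

Lemma rep_uy i : xi *: (rep_u i * upper 0 1 0)
  = if (m %| i)%Z then upper 0 xi 0 else 0.
Proof.
rewrite /rep_u; case: ifP => _.
  by rewrite upperM upperZ; congr upper; ring.
case: ifP => _; last by rewrite mul0r scaler0.
by rewrite upperM upperZ [RHS]upper0; congr upper; ring.
Qed.

(** The factor phi_i vanishes when i = -1 modulo m, which is what allows
    u_m = u_0 to be nonzero while y u_(m-1) = 0. *)
Lemma rep_phiu i : D_phi d xi rep_gens i * rep_u (i + 1)
  = if (m %| i)%Z then upper 0 xi 0 else 0.
Proof.
rewrite rep_phi -scalerAl mul1r /rep_u addrK.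
case: (boolP (m %| i + 1)%Z) => [mi|_].
  rewrite -{2}[i](addrK 1) ndvd1// (expfz_dvd gamma_m) ?subrr ?scale0r//.
  by rewrite -opprD rpredN.
case: ifP => mi; last by rewrite scaler0.
have -> : gamma ^ (- i - 1) = gamma^-1.
  rewrite expfzDr// (expfz_dvd gamma_m) ?rpredN// mul1r.
  by rewrite exprN1.
by rewrite upperZ /kappa; congr upper; rewrite ?mulr0// mulrC divfK.
Qed.

Lemma rep_powX i : powX rep_gens i = 1.
Proof. by case: i => n; rewrite /= expr1n. Qed.

(** When i + j = m - 1 the product of the phi_l is empty, so the first two
    cases in the definition of P_ij follow the same formula. *)
Lemma rep_P_small (i j : nat) : (i + j < m)%N ->
  D_P m d xi rep_gens i j
  = (\prod_(i <= l < m - 1 - j) (1 - gamma ^ (- l%:Z - 1)))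
    *: upper 0 1 0 ^+ (i + j).
Proof.
move=> ijm; rewrite /D_P rep_prod_phi -scalerAl mul1r; case: ifP => // ij2.
have ijE : (i + j + 1 == m)%N by lia.
by rewrite ijE big_geq ?scale1r//; lia.
Qed.

(** Either the power of y vanishes already, or the product of the phi_l runs
    through phi_(m-1) = 0. *)
Lemma rep_P_big (i j : nat) : (i < m)%N -> (j < m)%N -> (1 < i + j)%N ->
  D_P m d xi rep_gens i j = 0.
Proof.
move=> im jm ij1.
have E0 : upper 0 1 0 ^+ (i + j) = 0 :> 'M[k]_2.
  rewrite -(subnK ij1) exprD expr2 upperM !mul0r !mulr0 addr0 -upper0.
  by rewrite mulr0.
have [ijm|mij] := ltnP (i + j) m; first by rewrite rep_P_small// E0 scaler0.
rewrite /D_P !ifF; [|lia|lia].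
rewrite rep_prod_phi (_ : \prod_(i <= l < m) _ = 0) ?scale0r ?mul0r//.
have [n mE] : exists n, m = n.+1 by exists m.-1; lia.
rewrite mE big_nat_recr/=; last by rewrite -ltnS -mE.
rewrite [X in _ * (1 - X)](expfz_dvd gamma_m) ?subrr ?mulr0//.
by rewrite -opprD rpredN mE -[n%:Z + 1]/(n + 1)%:Z addn1 dvdzz.
Qed.

(** The relation for u_i u_j has content only when i + j <= 1: otherwise both
    sides vanish.  For i + j <= 1 the products of the phi_l are evaluated from
    phi_0 ... phi_(m-2) = m. *)
Lemma rep_D_relations : D_relations m d xi rep_gens.
Proof.
have E0 i : (upper 0 1 0 : 'M[k]_2) ^+ i.+2 = 0.
  by rewrite 2!exprS mulrA upperM !mul0r !mulr0 addr0 -upper0 mul0r.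
have [n mE] : exists n, m = n.+2 by exists m.-2; lia.
split.
- split; rewrite /= ?expr1n ?subrr ?mulr1 ?mul1r.
  + by [].
  + by rewrite !upperM upper1; split; congr upper; field.
  + split=> //; rewrite ?mulr1 ?mul1r// !upperM upperZ.
    by rewrite -/gamma; congr upper; ring.
  + by rewrite mE E0.
  + by rewrite upperX gamma_m expr1n -upper1 subrr.
- split=> i /=.
  + by rewrite /rep_u addrAC !(rpredDr _ (dvdzz m)).
  + by rewrite mul1r mulr1.
  + by rewrite rep_yu rep_phiu.
  + by rewrite expr1n mul1r rep_uy rep_phiu.
  + rewrite rep_powX -/gamma mul1r /rep_u; case: ifP => mi.
      by rewrite (expfz_dvd gamma_m)// scale1r !upperM; congr upper; ring.
    case: ifP => mi1; last by rewrite mulr0 mul0r scaler0.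
    rewrite -[i](subrK 1) expfzDr// (expfz_dvd gamma_m)// !upperM upperZ.
    by rewrite expr1z; congr upper; ring.
move=> i j im jm /=; rewrite rep_powX mul1r.
have [ij1|] := ltnP 1 (i + j).
  rewrite rep_P_big// mul0r scaler0.
  have [i1|i1] := ltnP 1 i; first by rewrite rep_u_ge2 ?i1// mul0r.
  have [j1|j1] := ltnP 1 j; first by rewrite [rep_u j]rep_u_ge2 ?j1// mulr0.
  have [-> ->] : i = 1%N /\ j = 1%N by lia.
  by rewrite rep_u1 upperM !mulr0 !mul0r addr0 -upper0.
have prod1 :
    \prod_(0 <= l < m - 2) (1 - gamma ^ (- l%:Z - 1)) * (1 - gamma) = m%:R.
  rewrite -prod_phi mE !subSS !subn0 big_nat_recr//=; congr (_ * (1 - _)).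
  rewrite -[gamma ^ _]mulr1 -[X in _ * X]gamma_m exprnP -expfzDr// mE.
  by rewrite -{1}[gamma]expr1z; congr (_ ^ _); lia.
have prod2 :
    (1 - gamma^-1) * \prod_(1 <= l < m - 1) (1 - gamma ^ (- l%:Z - 1)) = m%:R.
  by rewrite -prod_phi [RHS]big_ltn//; lia.
have m0 : m%:R != 0 :> k by exact: prim_root_natf_neq0 gamma_prim.
case: i j im jm => [|[|//]] [|[|//]] // im jm _; rewrite rep_P_small//= -/gamma
  ?addn0 ?add0n ?expr0 ?expr1.
- rewrite rep_u0 !subn0 prod_phi -scalerAl mul1r scalerA !mul1r upperM upperZ.
  by rewrite ?mulr1 ?mul1r mulVf// /gamma; congr upper; ring.
- rewrite rep_u0 rep_u1 -subnDA (canRL (mulfK gamma_den) prod1).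
  rewrite -scalerAl scalerA !upperM upperZ !exprN1 /kappa.
  rewrite invrN1; congr upper; rewrite ?(mulr0, mul0r, addr0, add0r, mul1r)//.
  rewrite /gamma; field.
  by rewrite m0 xi_neq0 gamma_den subr_eq0 gamma_neq1.
- rewrite rep_u0 rep_u1 !subn0 (canRL (mulKf kappa_den) prod2).
  rewrite -scalerAl scalerA !upperM upperZ.
  rewrite -[(-1) ^ _]/(1 : k) -[xi ^ _]/(1 : k) /kappa.
  congr upper; rewrite ?(mulr0, mul0r, addr0, add0r, mul1r)//.
  by rewrite /gamma; field; rewrite m0 xi_neq0 subr_eq0 gamma_neq1.
Qed.

End Representation.

(** * The comatrix coalgebra inside D(m, d, xi) *)

Lemma periodic_modz (T : Type) (m : nat) (h : int -> T) :
  (forall i, h (i + m%:Z) = h i) -> forall i, h i = h (i %% m)%Z.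
Proof.
move=> hm i; have hN j (n : nat) : h (j + (n * m)%:Z) = h j.
  elim: n j => [|n IH] j; first by rewrite mul0n addr0.
  by rewrite mulSn PoszD addrA IH hm.
rewrite {1}(divz_eq i m) addrC; case: (i %/ m)%Z => n.
  by rewrite -PoszM hN.
by rewrite -[LHS](hN _ n.+1) NegzE PoszM mulNr addrNK.
Qed.

Section ComatrixOfD.
Variables (k : fieldType) (m d : nat) (xi : k) (D : hopfAlgType k).
Variable a : D_generators D.
Hypotheses (m_gt1 : (1 < m)%N) (xi_prim : (2 * m).-primitive_root xi).
Hypotheses (relD : D_relations m d xi a) (comulD : D_comul m d xi a).

Let gamma := xi ^+ 2.
Let gamma_m : gamma ^+ m = 1.
Proof. exact: prim_expr_order (gamma_prim xi_prim). Qed.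
Let gamma_neq0 : gamma != 0.
Proof. by rewrite expf_neq0// (xi_neq0 m_gt1 xi_prim). Qed.

Definition z : D := genXV a ^+ d * genG a.

Lemma comm_genXV_genG : genXV a * genG a = genG a * genXV a.
Proof.
have [[[xV Vx] _ [xg _ _] _ _] _ _] := relD.
by rewrite -[RHS]mul1r -Vx -!mulrA [genX a * _]mulrA xg -mulrA xV mulr1.
Qed.

Lemma zX j : powX a (- (j * d)%:Z) * genG a ^+ j = z ^+ j.
Proof.
rewrite /z exprMn_comm; last exact/commr_sym/commrX/commr_sym/comm_genXV_genG.
by rewrite -exprM mulnC; case: (d * j)%N.
Qed.

Lemma z_m : z ^+ m = 1.
Proof.
have [[[xV Vx] _ _ _ /addrI/oppr_inj xg] _ _] := relD.
rewrite -zX -xg; case: (m * d)%N => [|n] /=; first by rewrite !expr0 mulr1.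
rewrite -exprMn_comm ?Vx ?expr1n//.
by rewrite /GRing.comm xV Vx.
Qed.

Lemma comul_z : comul z = z \ox z.
Proof.
have [cx cg _ _] := comulD; have [[[xV Vx] _ _ _ _] _ _] := relD.
have [c1 cM] := @comul_monoid_morphism k D.
have cV : comul (genXV a) = genXV a \ox genXV a.
  rewrite -[LHS]mulr1 -[X in _ * X]/(1 \ox 1) -xV -tensM mulrA -cx -cM Vx c1.
  by rewrite mul1r.
have cVX n : comul (genXV a ^+ n) = (genXV a ^+ n) \ox (genXV a ^+ n).
  by elim: n => [|n IH]; rewrite ?expr0 ?c1// !exprS cM IH cV tensM.
by rewrite /z cM cVX cg tensM.
Qed.

Lemma comul_zX n : comul (z ^+ n) = (z ^+ n) \ox (z ^+ n).
Proof.
have [c1 cM] := @comul_monoid_morphism k D.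
by elim: n => [|n IH]; rewrite ?expr0 ?c1// !exprS cM IH comul_z tensM.
Qed.

Lemma expfz_addm (i j : int) : gamma ^ (i + j * m%:Z) = gamma ^ i.
Proof.
by rewrite expfzDr// (expfz_dvd gamma_m (dvdz_mull j (dvdzz m))) mulr1.
Qed.

(** The formula for the coproduct of u_i extends from 0 <= i < m to all
    integers i, because gamma^j and u are periodic of period m. *)
Lemma comul_u (i : int) : comul (genU a i) =
  \sum_(j < m) gamma ^ (j%:Z * (i - j%:Z))
     *: (genU a j%:Z \ox (z ^+ j * genU a (i - j%:Z))).
Proof.
have [_ [um _ _ _ _] _] := relD.
pose G (i : int) := comul (genU a i) - \sum_(j < m) gamma ^ (j%:Z * (i - j%:Z))
     *: (genU a j%:Z \ox (z ^+ j * genU a (i - j%:Z))).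
apply/eqP; rewrite -subr_eq0 -/(G i); apply/eqP.
(* The difference of the two sides is periodic, so that it suffices to treat
   0 <= i < m. *)
have Gm t : G (t + m%:Z) = G t.
  rewrite /G um; congr (_ - _); apply: eq_bigr => j _.
  by rewrite addrAC um mulrDr expfz_addm.
rewrite (periodic_modz Gm).
have : (0 <= (i %% m)%Z < m)%R.
  by rewrite modz_ge0 ?ltz_pmod//; lia.
case: (i %% m)%Z => // n /andP[_ nm].
have [_ _ _ cu] := comulD; rewrite /G cu// big_mkord.
rewrite -sumrB big1// => j _.
by rewrite zX subrr.
Qed.

(** The factor gamma^(b (c - b)) is the one that absorbs the cocycle
    gamma^(j (i - j)) in the coproduct of u_i. *)
Definition entry (b c : nat) : D :=
  gamma ^ (b%:Z * (c%:Z - b%:Z)) *: (z ^+ b * genU a (c%:Z - b%:Z)).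

Lemma entryDl b c : entry (b + m) c = entry b c.
Proof.
have [_ [um _ _ _ _] _] := relD.
rewrite /entry exprD z_m mulr1; congr (_ *: (_ * _)).
  rewrite -[RHS](expfz_addm _ (c%:Z - b%:Z - b%:Z - m%:Z)).
  by congr (_ ^ _); rewrite PoszD; ring.
by rewrite -[LHS]um; congr (genU a _); rewrite PoszD; ring.
Qed.

Lemma entryDr b c : entry b (c + m) = entry b c.
Proof.
have [_ [um _ _ _ _] _] := relD.
by rewrite /entry PoszD addrAC um mulrDr expfz_addm.
Qed.

(** This is the identity
      b (c - b) + j (c - b - j) = b j + (b + j) (c - b - j)
    between the exponents of gamma in the j-th terms. *)
Lemma comul_entry_nat b c :
  comul (entry b c) = \sum_(j < m) entry b (b + j) \ox entry (b + j) c.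
Proof.
have [_ cM] := @comul_monoid_morphism k D.
have [tl tr] := tens_bilinear D D.
rewrite /entry (scalable_linear comul_linear) /= cM comul_zX comul_u.
rewrite mulr_sumr scaler_sumr; apply: eq_bigr => j _.
have mulZ e (t t' : tensor D D) : t * (e *: t') = e *: (t * t').
  exact: (scalable_linear (tmul_linearr t)).
rewrite mulZ scalerA tensM.
rewrite (scalable_linear (tl _)) (scalable_linear (tr _)) /= scalerA.
have -> : (b + j)%:Z - b%:Z = j%:Z by lia.
have -> : c%:Z - (b + j)%:Z = c%:Z - b%:Z - j%:Z by lia.
rewrite mulrA -exprD -!expfzDr//; congr (_ ^ _ *: _).
by rewrite PoszD; ring.
Qed.

Lemma entry_modl b c : entry (b %% m) c = entry b c.
Proof.
rewrite [in RHS](divn_eq b m) addnC; elim: (b %/ m)%N => [|q IH].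
  by rewrite mul0n addn0.
by rewrite mulSn [(m + _)%N]addnC addnA entryDl.
Qed.

Lemma entry_modr b c : entry b (c %% m) = entry b c.
Proof.
rewrite [in RHS](divn_eq c m) addnC; elim: (c %/ m)%N => [|q IH].
  by rewrite mul0n addn0.
by rewrite mulSn [(m + _)%N]addnC addnA entryDr.
Qed.

Lemma comul_entry (b c : 'I_m) :
  comul (entry b c) = \sum_(e < m) entry b e \ox entry e c.
Proof.
have [n mE] : exists n, m = n.+1 by exists m.-1; lia.
have modl i e : entry (i %% n.+1) e = entry i e by rewrite -mE entry_modl.
have modr i e : entry i (e %% n.+1) = entry i e by rewrite -mE entry_modr.
rewrite comul_entry_nat; move: b c; rewrite mE => b c.
(* The index e is b + j computed in the cyclic group of order m. *)
rewrite [RHS](reindex_inj (addrI b)) /=; apply: eq_bigr => j _.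
by rewrite modl modr.
Qed.

Section RepEntries.
Variable f : {lrmorphism D -> 'M[k]_2}.
Hypothesis fE : D_gen_map f a = rep_gens m xi.

Lemma rep_entry (b c : 'I_m) :
  f (entry b c) = upper (b == c)%:R
    (if (c == b.+1 %% m :> nat)%N then gamma ^+ b * (xi / (1 - gamma^-1))
     else 0)
    (if b == c then gamma ^+ b * xi else 0).
Proof.
have [fx fg fu] : [/\ f (genXV a) = 1, f (genG a) = upper 1 0 gamma
    & forall i, f (genU a i) = rep_u m xi i].
  by case: fE => _ -> -> _ _ fu; split=> // i; rewrite -fu.
have -> : f (entry b c) = gamma ^ (b%:Z * (c%:Z - b%:Z))
    *: ((f (genXV a) ^+ d * f (genG a)) ^+ b * f (genU a (c%:Z - b%:Z))).
  by rewrite /entry linearZ /= rmorphM rmorphXn /z rmorphM rmorphXn.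
rewrite fx fg fu expr1n mul1r upperX expr1n /rep_u.
have -> : (m %| c%:Z - b%:Z)%Z = (b == c).
  by rewrite -eqz_mod_dvd !modz_nat eqz_nat !modn_small// eq_sym.
have cbE : (m %| c%:Z - b%:Z - 1)%Z = (c == b.+1 %% m :> nat)%N.
  have -> : c%:Z - b%:Z - 1 = c%:Z - b.+1%:Z by lia.
  by rewrite -eqz_mod_dvd !modz_nat eqz_nat modn_small.
rewrite cbE; have [bc|bc] := eqVneq b c.
  subst c; rewrite subrr mulr0 expr0z scale1r upperM ifF.
    by congr upper; rewrite ?(mulr0, mul0r, addr0, mul1r).
  apply/negbTE; rewrite -cbE subrr add0r rpredN dvdz1.
  by rewrite neq_ltn m_gt1 orbT.
case: ifP => [cE|_]; last by rewrite mulr0 scaler0; exact: upper0.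
rewrite upperM upperZ; congr upper; rewrite ?(mulr0, mul0r, addr0, mul1r)//.
have -> : b%:Z * (c%:Z - b%:Z) = b%:Z + b%:Z * (c%:Z - b%:Z - 1) by ring.
by rewrite expfzDr// (expfz_dvd gamma_m (dvdz_mull _ _)) ?mulr1// cbE.
Qed.

Lemma functional_entry (i j : 'I_2) (M : 'M[k]_m) :
  (forall b c : 'I_m, f (entry b c) i j = M b c) ->
  functional_matrix (fun b c : 'I_m => entry b c) M.
Proof.
move=> h; exists (fun v => f v i j) => // e u v.
by rewrite linearP !mxE.
Qed.

(** The three entries of the representation induce the identity, a diagonal
    matrix with distinct entries and a shift along b |-> b + 1 modulo m. *)
Lemma entry_full (b c : 'I_m) :
  functional_matrix (fun b c : 'I_m => entry b c) (delta_mx b c).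
Proof.
pose d0 := \row_(b < m) (gamma ^+ b * xi).
pose nx (b : 'I_m) : 'I_m := Ordinal (ltn_pmod b.+1 (ltnW m_gt1)).
pose w (b : 'I_m) := gamma ^+ b * (xi / (1 - gamma^-1)).
pose e (b c : 'I_m) := entry b c.
have P_lin q M N := @functional_matrix_lin k D m e q M N.
have PM M N := @functional_matrixM k D m e comul_entry M N.
apply: (@generated_delta_mx k m _ _ P_lin PM d0 nx w).
- apply: (functional_entry (i := ord0) (j := ord0)) => b' c'.
  by rewrite rep_entry !mxE.
- move=> b' c'; rewrite !mxE => /(mulIf (xi_neq0 m_gt1 xi_prim))/eqP.
  rewrite (eq_prim_root_expr (gamma_prim xi_prim)) !modn_small//.
  by move/eqP/val_inj.
- move=> b'; rewrite /w !mulf_neq0 ?expf_neq0 ?(xi_neq0 m_gt1 xi_prim)//.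
  by rewrite invr_eq0 subr_eq0 eq_sym invr_eq1 (gamma_neq1 m_gt1 xi_prim).
- move=> b' c'.
  (* The number of steps is c' - b' modulo m; adding m keeps it nonnegative. *)
  exists (c' + (m - b'))%N; apply/val_inj.
  have it i : val (iter i nx b') = ((b' + i) %% m)%N.
    elim: i => [|i IH] /=; first by rewrite addn0 modn_small.
    by rewrite IH addnS -addn1 modnDml addn1.
  by rewrite it addnCA subnKC 1?ltnW// modnDr modn_small.
- apply: (functional_entry (i := ord_max) (j := ord_max)) => b' c'.
  by rewrite rep_entry !mxE /=; case: eqVneq.
- apply: (functional_entry (i := ord0) (j := ord_max)) => b' c'.
  rewrite rep_entry !mxE /= /w -val_eqE /=.
  by case: ifP.
Qed.

End RepEntries.

End ComatrixOfD.

Theorem proposition4p9 (k : closedFieldType) (m d : nat) (xi : k)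
  (D : hopfAlgType k)
  (k_char0 : [pchar k] =i pred0)
  (m_gt1 : (1 < m)%N)
  (d_gt0 : (0 < d)%N)
  (even_md : ~~ odd ((1 + m) * d))
  (xi_prim : (2 * m).-primitive_root xi)
  (D_def : is_D m d xi D) :
  ~ pointed D.
Proof.
move=> D_pointed; have [a [[relD univ] comulD _ _]] := D_def.
have [f [fE _]] := univ _ _ (rep_D_relations d m_gt1 xi_prim).
have full := entry_full m_gt1 xi_prim relD comulD fE.
have comul_e := comul_entry m_gt1 xi_prim relD comulD.
apply: (comatrix_span_not_one_dimensional full m_gt1).
exact/D_pointed/simple_comatrix_span/ltnW.
Qed.
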